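(* Let $n$ be a positive integer. Then $\mathrm{End}\,\vec{P}_n=\{1_n\}$, where $1_n$ is the identity map of $\{1,\ldots,n\}$.
   Context: $\vec{P}_n$ denotes the directed path with vertex set $\{1,\ldots,n\}$ and edge set $E=\{(i,i+1) : i=1,\ldots,n-1\}$. $\mathrm{End}\,\vec{P}_n$ denotes the set of all endomorphisms of $\vec{P}_n$, i.e. the maps $\alpha:\{1,\ldots,n\}\to\{1,\ldots,n\}$ such that, for all vertices $u,v$, $(u,v)\in E$ implies $(u\alpha,v\alpha)\in E$ (maps are written on the right of their arguments). *)

(* Defs.v *)
From mathcomp Require Import all_boot.

Set Implicit Arguments.
Unset Strict Implicit.
Unset Printing Implicit Defensive.

Definition digraph_End (T : finType) (e : rel T) : {set {ffun T -> T}} :=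
  [set f : {ffun T -> T} |
     [forall u, forall v, e u v ==> e (f u) (f v)]].

(* The vertex i of {1, ..., n} is represented by the ordinal i - 1 : 'I_n, so
   the edges (i, i + 1), 1 <= i <= n - 1, are the pairs of ordinals with
   consecutive values. *)
Definition dpath (n : nat) : rel 'I_n :=
  fun u v => nat_of_ord v == u.+1.

(* Main.v *)
Require Import Defs.
From mathcomp Require Import all_boot.

(** An endomorphism sends each edge to an edge, so its value grows by exactly
    one along the path: it is the translation by its value at the first vertex
    ([dpath_endo_translation]). The image of the last vertex must still be a
    vertex, which leaves no room for a translation by a positive amount. *)

Lemma digraph_EndP (T : finType) (e : rel T) (f : {ffun T -> T}) :
  reflect (forall u v, e u v -> e (f u) (f v)) (f \in digraph_End e).
Proof.
rewrite inE; apply: (iffP forallP) => [H u v | H u].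
  by move/forallP: (H u) => /(_ v) /implyP.
by apply/forallP => v; apply/implyP; apply: H.
Qed.

Lemma dpath_endo_translation (n : nat) (f : {ffun 'I_n.+1 -> 'I_n.+1}) :
  f \in digraph_End (@dpath n.+1) -> forall i, f i = f ord0 + i :> nat.
Proof.
move=> /digraph_EndP fE [k lt_k].
elim: k lt_k => [|k IHk] lt_k.
  by rewrite addn0; congr (nat_of_ord (f _)); apply: val_inj.
have edge : dpath (Ordinal (ltnW lt_k)) (Ordinal lt_k) by apply: eqxx.
by move/eqP: (fE _ _ edge) => ->; rewrite IHk /= addnS.
Qed.

Theorem theorem1p3 (n : nat) (hn : 0 < n) :
  digraph_End (@dpath n) = [set [ffun i : 'I_n => i]].
Proof.
case: n hn => // n _.
apply/setP => f; rewrite in_set1; apply/idP/eqP => [fE | ->].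
- have transl := dpath_endo_translation _ _ fE.
  have f0 : f ord0 = 0 :> nat.
    have := ltn_ord (f ord_max).
    by rewrite transl /= ltnS -[leqRHS]add0n leq_add2r leqn0 => /eqP.
  by apply/ffunP => i; rewrite ffunE; apply: val_inj; rewrite /= transl f0.
- by apply/digraph_EndP => u v; rewrite !ffunE.
Qed.
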